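(* Let $L\subset \mathrm{Vec}^{c}(\mathbb{A}^2)$ be a Lie subalgebra isomorphic to $\mathfrak{saff}_2$. Then there is an étale map $\alpha=(f,g)$ such that $L=\alpha(\mathfrak{saff}_2)$. More precisely, if $f,g\in K[x,y]$ are such that $(D_f,D_g)$ is a basis of $\mathrm{rad}(L)$, then $$L=\langle D_f,D_g,D_{f^2},D_{g^2},D_{fg}\rangle,$$ and one can take $\alpha=(f,g)$ (that is, $(f,g)$ is étale and $L=\alpha(\mathfrak{saff}_2)$ for $\alpha=(f,g)$).
   Context: $K$ is an algebraically closed field of characteristic zero and $\mathbb{A}^2=K^2$. $\mathrm{Vec}(\mathbb{A}^2)=\{p\,\partial_x+q\,\partial_y \mid p,q\in K[x,y]\}=\mathrm{Der}_K(K[x,y])$ is the Lie algebra of polynomial vector fields, $\mathrm{div}(p\,\partial_x+q\,\partial_y)=p_x+q_y$, and $\mathrm{Vec}^{c}(\mathbb{A}^2)=\{D\mid \mathrm{div}\,D\in K\}$. For $h\in K[x,y]$, $D_h:=h_x\partial_y-h_y\partial_x$. $\langle\cdots\rangle$ denotes $K$-linear span, and $\mathrm{rad}$ denotes the solvable radical of a Lie algebra. $\mathfrak{saff}_2$ is the Lie algebra of the group of affine transformations of $\mathbb{A}^2$ of determinant 1, identified with $\langle \partial_x,\partial_y,x\partial_x-y\partial_y,x\partial_y,y\partial_x\rangle\subset \mathrm{Vec}^c(\mathbb{A}^2)$. For a $K$-algebra endomorphism $\alpha$ of $K[x,y]$ write $\alpha=(f,g)$ if $\alpha(x)=f$, $\alpha(y)=g$,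 and put $j(\alpha)=f_xg_y-f_yg_x$. $\alpha$ is étale if $j(\alpha)\in K^*$. An étale $\alpha=(f,g)$ induces an injective Lie algebra homomorphism $\mathrm{Vec}(\mathbb{A}^2)\to \mathrm{Vec}(\mathbb{A}^2)$, $D\mapsto\alpha(D)$, given for $D=p\,\partial_x+q\,\partial_y$ by $$\alpha(D)=\frac{1}{j(\alpha)}\Big(\big(g_y\alpha(p)-f_y\alpha(q)\big)\partial_x+\big(-g_x\alpha(p)+f_x\alpha(q)\big)\partial_y\Big);$$ it satisfies $\alpha(D)\circ\alpha=\alpha\circ D$. *)

(* Defs.v *)
From HB Require Import structures.
From mathcomp Require Import all_boot all_order all_algebra ring.
From mathcomp.multinomials Require Import mpoly.

Set Implicit Arguments.
Unset Strict Implicit.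
Unset Printing Implicit Defensive.

Import GRing.Theory.
Local Open Scope ring_scope.

Section LinearAlgebra.

Variables (K : fieldType) (V : lmodType K).

Definition subspace (S : V -> Prop) : Prop :=
  S 0 /\ forall (a : K) (u v : V), S u -> S v -> S (a *: u + v).

Definition linear_span (A : V -> Prop) (v : V) : Prop :=
  exists (n : nat) (c : 'I_n -> K) (u : 'I_n -> V),
    (forall i, A (u i)) /\ v = \sum_(i < n) c i *: u i.

Definition span_seq (s : seq V) : V -> Prop := linear_span (fun u => u \in s).

Definition lin_indep (s : seq V) : Prop :=
  forall c : 'I_(size s) -> K,
    \sum_(i < size s) c i *: s`_i = 0 -> forall i, c i = 0.

Definition basis_of_space (s : seq V) (S : V -> Prop) : Prop :=
  lin_indep s /\ (forall v, S v <-> span_seq s v).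

End LinearAlgebra.

(* The Lie bracket is an explicit parameter [br]. *)
Section LieAlgebra.

Variables (K : fieldType) (V : lmodType K) (br : V -> V -> V).

Definition lie_subalgebra (L : V -> Prop) : Prop :=
  subspace L /\ forall u v, L u -> L v -> L (br u v).

Definition lie_ideal (L I : V -> Prop) : Prop :=
  [/\ subspace I, forall v, I v -> L v
    & forall u v, L u -> I v -> I (br u v)].

Definition derived_subalgebra (S : V -> Prop) : V -> Prop :=
  linear_span (fun w => exists u v, [/\ S u, S v & w = br u v]).

Definition lie_solvable (S : V -> Prop) : Prop :=
  exists n : nat, forall v, iter n derived_subalgebra S v -> v = 0.

(* R is the largest solvable ideal of L; it exists as soon as L is
   finite-dimensional, and is obviously unique. *)
Definition is_solvable_radical (L R : V -> Prop) : Prop :=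
  [/\ lie_ideal L R, lie_solvable R
    & forall I, lie_ideal L I -> lie_solvable I -> forall v, I v -> R v].

(* Only the restriction of phi to L is relevant. *)
Definition lie_isomorphic (L M : V -> Prop) : Prop :=
  exists phi : V -> V,
    [/\ forall (a : K) u v, L u -> L v -> phi (a *: u + v) = a *: phi u + phi v,
        forall u v, L u -> L v -> phi (br u v) = br (phi u) (phi v),
        forall u v, L u -> L v -> phi u = phi v -> u = v
      & forall w, M w <-> exists2 u, L u & phi u = w].

End LieAlgebra.

Notation Kxy K := {mpoly K[2]}.

(* The pair (p, q) stands for the vector field p d/dx + q d/dy, where
   x = 'X_0 and y = 'X_1. *)
Notation Vec K := ({mpoly K[2]} * {mpoly K[2]})%type.

Section VectorFields.

Variable K : fieldType.

Implicit Types (h p : Kxy K) (D E : Vec K) (alpha : {lrmorphism Kxy K -> Kxy K}).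

Definition dx p : Kxy K := p^`M(0).
Definition dy p : Kxy K := p^`M(1).

Definition vf_app D p : Kxy K := D.1 * dx p + D.2 * dy p.

(* The coordinates of D \o E - E \o D are its values at x and y. *)
Definition vf_lie D E : Vec K :=
  (vf_app D E.1 - vf_app E D.1, vf_app D E.2 - vf_app E D.2).

Lemma vf_lieE D E p :
  vf_app (vf_lie D E) p = vf_app D (vf_app E p) - vf_app E (vf_app D p).
Proof.
rewrite /vf_app /vf_lie /vf_app /dx /dy /= !mderivD !mderivM.
rewrite [(p^`M(1))^`M(0)]mderiv_comm; ring.
Qed.

Definition vf_div D : Kxy K := dx D.1 + dy D.2.

Definition in_Vecc D : Prop := exists c : K, vf_div D = c%:MP.

Definition ham h : Vec K := (- dy h, dx h).

Definition saff2 : Vec K -> Prop :=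
  span_seq [:: ((1, 0) : Vec K); (0, 1); ('X_0, - 'X_1); (0, 'X_0); ('X_1, 0)].

Definition jac alpha : Kxy K :=
  dx (alpha 'X_0) * dy (alpha 'X_1) - dy (alpha 'X_0) * dx (alpha 'X_1).

Definition etale alpha : Prop := exists2 c : K, c != 0 & jac alpha = c%:MP.

(* The inverse is taken in K[x, y]; it is meaningful for etale alpha, whose
   Jacobian is a nonzero constant. *)
Definition vf_act alpha D : Vec K :=
  let f := alpha 'X_0 in let g := alpha 'X_1 in
  ((jac alpha)^-1 * (dy g * alpha D.1 - dy f * alpha D.2),
   (jac alpha)^-1 * (- dx g * alpha D.1 + dx f * alpha D.2)).

Definition vf_image alpha (L : Vec K -> Prop) (D : Vec K) : Prop :=
  exists2 E, L E & vf_act alpha E = D.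

End VectorFields.

(* Main.v *)
From HB Require Import structures.
Require Import Defs.
From mathcomp Require Import all_boot all_order all_algebra ring.
From mathcomp.multinomials Require Import mpoly.
Import GRing.Theory.
Local Open Scope ring_scope.

Set Implicit Arguments.
Unset Strict Implicit.

(** Why the theorem is true.  Taking divergences, [vf_div_lie] shows that a
    bracket of two fields of constant divergence is divergence free.  The
    algebra [saff2] equals its own derived algebra, hence so does L, and so L
    consists of divergence-free fields.  In characteristic zero these are
    exactly the Hamiltonian fields [ham u] ([div0_ham]), whose brackets are
    given by the Poisson bracket: [ham] turns [poisson] into [vf_lie] and kills
    only the constants.

    Fix an isomorphism from L to [saff2] and let [ham f], [ham g] be the
    elements of L sent to d/dx and d/dy.  The brackets of an arbitrary
    [ham u] of L with these two are prescribed by [saff2], so {u, f} and {u, g}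
    are affine in f and g ([frame_brackets]); in particular {f, g} is a
    constant c.

    The heart of the matter is that c is not zero.  If it were, f and g would
    be algebraically dependent.  With h and e the Hamiltonians of the fields
    sent to x d/dx - y d/dy and x d/dy, the Pluecker relation between the four
    gradients gives an explicit relation, quadratic in g and linear in f, and
    this relation is incompatible with the weights -1 and 1 of f and g under h
    ([poisson_nondegenerate]).

    Once c is invertible, the gradient of u can be recovered from {u, f} and
    {u, g}.  Since these are affine in f and g, u must be a polynomial of
    degree at most 2 in f and g, with explicit coefficients
    ([ham_affine_brackets]); hence L is the span of [ham] of f, g, f^2, g^2, fg
    ([L_quad]).  The same span is the image of [saff2] under the endomorphism
    (f, g), by direct computation ([vf_image_saff2]).

    Finally, [ham f] and [ham g] span an abelian ideal of L, so they lie in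
    the radical R.  If ([ham f'], [ham g']) is any basis of R, then f and g are
    affine in f' and g'.  As {f, g} is nonzero, this affine substitution is
    invertible, and therefore {f', g'} is also a nonzero constant and f', g'
    define the same span ([frame_change]). *)

(** * The Euler operator *)

Section Euler.
Variables (K : fieldType) (n : nat).
Implicit Types (p q u : {mpoly K[n]}) (m : 'X_{1..n}) (k : nat).

Definition euler u : {mpoly K[n]} := \sum_(i < n) 'X_i * u^`M(i).

Lemma euler_is_linear : linear euler.
Proof.
move=> a u v; rewrite /euler scaler_sumr -big_split; apply: eq_bigr => i _.
by rewrite mderivD mderivZ mulrDr scalerAr.
Qed.

HB.instance Definition _ :=
  GRing.isLinear.Build K {mpoly K[n]} {mpoly K[n]} _ euler euler_is_linear.

Lemma eulerX m : euler 'X_[m] = (mdeg m)%:R *: 'X_[m].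
Proof.
rewrite /euler mdegE natr_sum scaler_suml; apply: eq_bigr => i _.
rewrite mderivX -scalerAr -mpolyXD.
have [mi0|] := eqVneq (m i) 0%N; first by rewrite mi0 !scale0r.
by rewrite -lep1mP => le1; rewrite addmC submK.
Qed.

Lemma mcoeff_euler u m : (euler u)@_m = (mdeg m)%:R * u@_m.
Proof.
rewrite [u in RHS]mpolyE {1}(mpolyE u) [euler _]linear_sum.
rewrite !(linear_sum (mcoeff m)) mulr_sumr; apply: eq_bigr => m' _ /=.
rewrite [euler _]linearZ /= eulerX !mcoeffZ mcoeffX.
by case: eqP => [->|_]; rewrite ?mulr0 // mulrCA.
Qed.

Hypothesis charK : [pchar K] =i pred0.

(** In characteristic zero, adding a positive constant to the Euler operator
    makes all its eigenvalues nonzero on the monomials, so that it becomes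
    bijective.  This replaces integration in [div0_ham]. *)
Lemma add_euler_inj k u : euler u + k.+1%:R *: u = 0 -> u = 0.
Proof.
move/mpolyP=> eq_u; apply/mpolyP=> m; move/(_ m)/eqP: eq_u.
rewrite mcoeffD mcoeff_euler mcoeffZ -mulrDl -natrD mcoeff0 mulf_eq0.
by rewrite ((pcharf0P K).1 charK) addnS => /eqP.
Qed.

Lemma add_euler_surj k p : exists u, euler u + k.+1%:R *: u = p.
Proof.
exists (\sum_(m <- msupp p) (p@_m / (mdeg m + k.+1)%:R) *: 'X_[m]).
rewrite linear_sum scaler_sumr -big_split [RHS]mpolyE; apply: eq_bigr => m _.
rewrite /= [euler _]linearZ /= eulerX 2!scalerA -scalerDl [k.+1%:R * _]mulrC.
by rewrite -mulrDr -natrD divfK // ((pcharf0P K).1 charK) addnS.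
Qed.

End Euler.

(** * Hamiltonian fields and the Poisson bracket *)

Section Hamiltonian.
Variable K : fieldType.
Implicit Types (f g h u : Kxy K) (D E : Vec K) (c : K).

Lemma mderivXU (i j : 'I_2) : ('X_j : Kxy K)^`M(i) = (j == i)%:R.
Proof.
rewrite mderivX mnm1E; case: eqP => [->|_]; last by rewrite scale0r.
by rewrite -[X in (X - _)%MM]add0m addmK mpolyX0 scale1r.
Qed.

Definition mderivE := (mderivD, mderivB, mderivN, mderivM, @mderivC, @mderivXU).

(** The sign is the one for which [poisson f g] is the value of the derivation
    [ham f] at g. *)
Definition poisson f g : Kxy K := dx f * dy g - dy f * dx g.

(** No constant term, as [ham] kills constants. *)
Definition quad (a b p q r : K) f g : Kxy K :=
  a%:MP * f + b%:MP * g + p%:MP * (f * f) + q%:MP * (g * g) + r%:MP * (f * g).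

Lemma vecZ c D : c *: D = (c%:MP * D.1, c%:MP * D.2).
Proof. by case: D => p q; rewrite !mul_mpolyC. Qed.

Lemma hamD f g : ham (f + g) = ham f + ham g.
Proof. by congr pair; rewrite /= /dx /dy mderivD ?opprD. Qed.

Lemma hamZ c f : ham (c%:MP * f) = c *: ham f.
Proof. by rewrite vecZ; congr pair; rewrite /= /dx /dy !mderivE; ring. Qed.

Lemma hamC c : ham c%:MP = 0.
Proof. by rewrite /ham /dx /dy !mderivC oppr0. Qed.

Lemma vf_lie_ham f g : vf_lie (ham f) (ham g) = ham (poisson f g).
Proof.
rewrite /vf_lie /ham /vf_app /poisson /dx /dy; congr pair => /=; rewrite !mderivE;
  rewrite [f^`M(1)^`M(0)]mderiv_comm [g^`M(1)^`M(0)]mderiv_comm; ring.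
Qed.

Lemma vf_divD D E : vf_div (D + E) = vf_div D + vf_div E.
Proof. by rewrite /vf_div /dx /dy !mderivD addrACA. Qed.

Lemma vf_div_lie D E :
  vf_div (vf_lie D E) = vf_app D (vf_div E) - vf_app E (vf_div D).
Proof.
rewrite /vf_div /vf_lie /vf_app /dx /dy /= !mderivE.
rewrite [D.1^`M(1)^`M(0)]mderiv_comm [E.1^`M(1)^`M(0)]mderiv_comm.
rewrite [D.2^`M(1)^`M(0)]mderiv_comm [E.2^`M(1)^`M(0)]mderiv_comm; ring.
Qed.

(** When {f, g} = c is constant, Cramer's rule gives
    c grad u = {u, g} grad f - {u, f} grad g.  The opposite coefficients of f in
    {u, f} and of g in {u, g} make the right-hand side a gradient, and the
    factors 2 make its primitive free of denominators. *)
Lemma ham_affine_brackets f g u (c a0 a1 a2 b0 b1 : K) :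
  poisson f g = c%:MP ->
  poisson u f = a0%:MP + a1%:MP * f + (2 * a2)%:MP * g ->
  poisson u g = b0%:MP + (2 * b1)%:MP * f - a1%:MP * g ->
  c *: ham u = ham (quad b0 (- a0) b1 (- a2) (- a1) f g).
Proof.
move=> fgc uf ug.
have cux : c%:MP * dx u = dx f * poisson u g - dx g * poisson u f.
  by rewrite -fgc /poisson; ring.
have cuy : c%:MP * dy u = dy f * poisson u g - dy g * poisson u f.
  by rewrite -fgc /poisson; ring.
rewrite vecZ /= mulrN cux cuy uf ug /ham /quad /dx /dy !mderivE.
by congr pair; ring.
Qed.

Lemma quad_affine (a b e a' b' e' : K) (p q r s t : K) f g f0 g0 :
  f0 = a%:MP * f + b%:MP * g + e%:MP -> g0 = a'%:MP * f + b'%:MP * g + e'%:MP ->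
  exists p' q' r' s' t', ham (quad p q r s t f0 g0) = ham (quad p' q' r' s' t' f g).
Proof.
move=> -> ->.
exists (p * a + q * a' + 2 * r * a * e + 2 * s * a' * e' + t * (a * e' + a' * e)).
exists (p * b + q * b' + 2 * r * b * e + 2 * s * b' * e' + t * (b * e' + b' * e)).
exists (r * a ^+ 2 + s * a' ^+ 2 + t * a * a').
exists (r * b ^+ 2 + s * b' ^+ 2 + t * b * b').
exists (2 * r * a * b + 2 * s * a' * b' + t * (a * b' + a' * b)).
by congr pair; rewrite /quad /dx /dy !mderivE; ring.
Qed.

Lemma poisson_affine (a b e a' b' e' : K) f g f0 g0 :
  f0 = a%:MP * f + b%:MP * g + e%:MP -> g0 = a'%:MP * f + b'%:MP * g + e'%:MP ->
  poisson f0 g0 = (a * b' - a' * b)%:MP * poisson f g.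
Proof. by move=> -> ->; rewrite /poisson /dx /dy !mderivE; ring. Qed.

Hypothesis charK : [pchar K] =i pred0.

Lemma euler2 f : euler f = 'X_0 * dx f + 'X_1 * dy f.
Proof.
rewrite /euler !big_ord_recl big_ord0 addr0 (_ : lift _ _ = 1) //.
exact: val_inj.
Qed.

Lemma ham_eq0 f : ham f = 0 -> exists c, f = c%:MP.
Proof.
move=> hf; have fx : dx f = 0 := congr1 snd hf.
have /eqP : - dy f = 0 := congr1 fst hf; rewrite oppr_eq0 => /eqP fy.
exists f@_0.
apply/mpolyP=> m; rewrite mcoeffC.
have [->|m0] := eqVneq m 0%MM; first by rewrite mulr1.
have : euler f = 0 by rewrite euler2 fx fy !mulr0 addr0.
move/mpolyP/(_ m)/eqP; rewrite mcoeff_euler mcoeff0 mulf_eq0.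
by rewrite ((pcharf0P K).1 charK) mdeg_eq0 (negPf m0) mulr0 => /eqP.
Qed.

Lemma ham_inj f g : ham f = ham g -> exists c, f = g + c%:MP.
Proof.
move=> fg; have [|c fgc] := @ham_eq0 (f + (-1)%:MP * g).
  by rewrite hamD hamZ fg scaleN1r subrr.
by exists c; rewrite -fgc; ring.
Qed.

(** The Poincare lemma for the 1-form q dx - p dy, by the radial homotopy: on
    the homogeneous part of degree d, the Hamiltonian is (x q - y p) / (d + 1).
    The polynomials u and v of the proof are p and q so divided. *)
Lemma div0_ham D : vf_div D = 0 -> exists h, D = ham h.
Proof.
case: D => p q div0.
have [u up] := add_euler_surj charK 0 p.
have [v vq] := add_euler_surj charK 0 q.
(* Differentiation lowers the degree by 1, which turns 1 + euler into 2 + euler. *)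
have uv : dx u + dy v = 0.
  apply: (@add_euler_inj _ _ charK 1); rewrite -[RHS]div0 /vf_div /= -up -vq.
  rewrite !euler2 -!mul_mpolyC !rmorph_nat /dx /dy !mderivE /=.
  by rewrite [u^`M(1)^`M(0)]mderiv_comm [v^`M(1)^`M(0)]mderiv_comm; ring.
have vy : dy v = - dx u by apply/eqP; rewrite -addr_eq0 addrC uv.
exists ('X_0 * v - 'X_1 * u); rewrite -up -vq !euler2 !scale1r.
rewrite /ham vy /dx /dy !mderivE -[v^`M(1)]/(dy v) vy /dx /=; congr pair; ring.
Qed.

(** The bracket relations are those of d/dx, d/dy, x d/dx - y d/dy and
    x d/dy, each up to a constant.  The Pluecker relation
    {e, f}{h, g} - {e, g}{h, f} = {e, h}{f, g} and the assumption {f, g} = 0 give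
    (k3 - g)(k2 + g) = k4 (k1 - f).  Up to constants f and g have weights -1 and
    1 under {h, _}, so applying {h, _} doubles the leading term of the left
    side while it changes the sign of the right side: g satisfies a
    nontrivial polynomial equation, hence is constant. *)
Lemma poisson_nondegenerate f g h e (k1 k2 k3 k4 : K) :
  poisson h f = k1%:MP - f -> poisson h g = k2%:MP + g ->
  poisson e f = k3%:MP - g -> poisson e g = k4%:MP ->
  poisson f g = 0 -> ham g = 0.
Proof.
move=> hf hg ef eg fg.
have rel : (k3%:MP - g) * (k2%:MP + g) = k4%:MP * (k1%:MP - f).
  rewrite -hf -hg -ef -eg; apply/eqP; rewrite -subr_eq0.
  have -> : poisson e f * poisson h g - poisson e g * poisson h f
            = poisson e h * poisson f g by rewrite /poisson; ring.
  by rewrite fg mulr0.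
have drel : (k3 - k2)%:MP * poisson h g - 2 * g * poisson h g = - k4%:MP * poisson h f.
  transitivity (poisson h ((k3%:MP - g) * (k2%:MP + g))).
    by rewrite /poisson /dx /dy !mderivE; ring.
  by rewrite rel /poisson /dx /dy !mderivE; ring.
have : (k2%:MP + g) * ((2 * k3 - k2)%:MP - 3 * g) = 0.
  transitivity ((k3 - k2)%:MP * poisson h g - 2 * g * poisson h g
    + (k3%:MP - g) * (k2%:MP + g)); first by rewrite hg; ring.
  by rewrite drel rel hf; ring.
have n0 j : (j.+1%:R : K) != 0 by rewrite ((pcharf0P K).1 charK).
move/eqP; rewrite mulf_eq0 => /orP[]/eqP g0.
  by rewrite -[g](addKr k2%:MP) g0 addr0 -mpolyCN hamC.
suff -> : g = ((2 * k3 - k2) / 3)%:MP by exact: hamC.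
apply: (@mulIf _ 3%:MP); first by rewrite mpolyC_eq0 n0.
rewrite -rmorphM /= divfK ?n0 //.
by apply/esym/eqP; rewrite -subr_eq0 -[X in _ == X]g0; apply/eqP; ring.
Qed.
End Hamiltonian.

(** * The algebra saff2 and the fields with quadratic Hamiltonian *)

Section Spans.
Variable K : fieldType.
Implicit Types (f g : Kxy K) (D : Vec K).

Lemma span_seqP (V : lmodType K) (s : seq V) (v : V) :
  span_seq s v <-> exists c : 'I_(size s) -> K, v = \sum_i c i *: s`_i.
Proof.
split=> [[n [c [u [us ->]]]]|[c ->]]; last first.
  by exists (size s), c, (fun i => s`_i); split=> // i; rewrite mem_nth.
pose P w := exists c : 'I_(size s) -> K, w = \sum_i c i *: s`_i.
apply: (big_ind P) => [|w1 w2 [c1 ->] [c2 ->]|i _].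
- by exists (fun _ => 0); rewrite big1 // => i _; rewrite scale0r.
- exists (fun i => c1 i + c2 i); rewrite -big_split.
  by apply: eq_bigr => i _; rewrite scalerDl.
- have lt_i : (index (u i) s < size s)%N by rewrite index_mem us.
  exists (fun j => if j == Ordinal lt_i then c i else 0).
  rewrite (bigD1 (Ordinal lt_i)) //= eqxx nth_index ?us // big1 ?addr0 // => j.
  by move/negPf=> ->; rewrite scale0r.
Qed.

Definition saff_field (a b c d e : K) : Vec K :=
  (a%:MP + c%:MP * 'X_0 + e%:MP * 'X_1, b%:MP + d%:MP * 'X_0 - c%:MP * 'X_1).

Lemma saff2P D : saff2 D <-> exists a b c d e, D = saff_field a b c d e.
Proof.
split=> [/span_seqP[c ->]|[a [b [c [d [e ->]]]]]].
  rewrite !big_ord_recl big_ord0 /= !vecZ /=.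
  move: (c _) => a; move: (c _) => b; move: (c _) => k; move: (c _) => d.
  move: (c _) => e.
  by exists a, b, k, d, e; congr pair => /=; ring.
apply/span_seqP; exists (fun i => [:: a; b; c; d; e]`_i).
rewrite !big_ord_recl big_ord0 /= !vecZ /=.
by congr pair => /=; ring.
Qed.

Lemma vf_lie_saff_field (a b c d e a' b' c' d' e' : K) :
  vf_lie (saff_field a b c d e) (saff_field a' b' c' d' e') =
  saff_field (a * c' + b * e' - a' * c - b' * e) (a * d' - b * c' - a' * d + b' * c)
    (d * e' - d' * e) (2 * (c * d' - c' * d)) (2 * (e * c' - e' * c)).
Proof.
rewrite /vf_lie /vf_app /saff_field /dx /dy /= !mderivE /=.
by congr pair; ring.
Qed.

Lemma saff_field_lin (k a b c d e a' b' c' d' e' : K) :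
  k *: saff_field a b c d e + saff_field a' b' c' d' e' =
  saff_field (k * a + a') (k * b + b') (k * c + c') (k * d + d') (k * e + e').
Proof. by rewrite vecZ; congr pair => /=; ring. Qed.

Lemma saff_field0 : saff_field 0 0 0 0 0 = 0 :> Vec K.
Proof. by congr pair; ring. Qed.

Definition quad_fields f g D := exists a b p q r, D = ham (quad a b p q r f g).

Lemma ham_quad (a b p q r : K) f g :
  ham (quad a b p q r f g) =
  a *: ham f + b *: ham g + p *: ham (f * f) + q *: ham (g * g) + r *: ham (f * g).
Proof. by rewrite /quad !hamD !hamZ. Qed.

Lemma span_quad f g D :
  span_seq [:: ham f; ham g; ham (f ^+ 2); ham (g ^+ 2); ham (f * g)] D
  <-> quad_fields f g D.
Proof.
split=> [/span_seqP[c ->]|[a [b [p [q [r ->]]]]]].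
  rewrite !big_ord_recl big_ord0 /= !expr2 addr0 !addrA.
  by do 5!eexists; rewrite ham_quad.
apply/span_seqP; exists (fun i => [:: a; b; p; q; r]`_i).
by rewrite !big_ord_recl big_ord0 /= ham_quad !expr2 addr0 !addrA.
Qed.

Lemma span_ham2 f g h : [pchar K] =i pred0 -> span_seq [:: ham f; ham g] (ham h) ->
  exists a b e : K, h = a%:MP * f + b%:MP * g + e%:MP.
Proof.
move=> charK /span_seqP[c]; rewrite !big_ord_recl big_ord0 /= addr0.
rewrite -!hamZ -hamD => /(ham_inj charK)[e ->].
by do 3!eexists.
Qed.

Lemma quad_fields_affine (a b e a' b' e' : K) f g f0 g0 :
  f0 = a%:MP * f + b%:MP * g + e%:MP -> g0 = a'%:MP * f + b'%:MP * g + e'%:MP ->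
  forall D, quad_fields f0 g0 D -> quad_fields f g D.
Proof.
move=> ef eg D [p [q [r [s [t ->]]]]].
have [p' [q' [r' [s' [t' ->]]]]] := quad_affine p q r s t ef eg.
by exists p', q', r', s', t'.
Qed.

(** The substitution that expresses (f0, g0) in (f, g) multiplies the Poisson
    bracket by its determinant; as {f0, g0} is not zero, neither is the
    determinant, and the substitution can be inverted. *)
Lemma frame_change (a b e a' b' e' c0 : K) f g f0 g0 :
  f0 = a%:MP * f + b%:MP * g + e%:MP -> g0 = a'%:MP * f + b'%:MP * g + e'%:MP ->
  poisson f0 g0 = c0%:MP -> c0 != 0 ->
  (exists2 c : K, c != 0 & poisson f g = c%:MP) /\
  forall D, quad_fields f0 g0 D <-> quad_fields f g D.
Proof.
move=> ef eg f0g0 c0n0; have := f0g0; rewrite (poisson_affine ef eg) => fg.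
set det := a * b' - a' * b in fg.
have detn0 : det != 0.
  apply: contraNneq c0n0 => det0.
  by rewrite -(mpolyC_eq0 2) -fg det0 mul0r.
have cancel_det h : (det^-1)%:MP * (det%:MP * h) = h.
  by rewrite mulrA -rmorphM mulVf // rmorph1 mul1r.
split.
  exists (det^-1 * c0); first by rewrite mulf_neq0 ?invr_eq0.
  by rewrite rmorphM /= -fg cancel_det.
move=> D; split; first exact: (quad_fields_affine ef eg).
apply: (@quad_fields_affine (det^-1 * b') (- (det^-1 * b)) (det^-1 * (b * e' - b' * e))
          (- (det^-1 * a')) (det^-1 * a) (det^-1 * (a' * e - a * e'))).
  by rewrite -[LHS]cancel_det ef eg /det; ring.
by rewrite -[LHS]cancel_det ef eg /det; ring.
Qed.

Section Image.
Variables (alpha : {lrmorphism Kxy K -> Kxy K}) (c : K).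
Let f := alpha 'X_0.
Let g := alpha 'X_1.
Hypotheses (cn0 : c != 0) (fg : poisson f g = c%:MP).

(** The factors 2 on the last two coefficients avoid halves: x d/dy and y d/dx
    correspond to f^2 / 2 and - g^2 / 2. *)
Lemma vf_act_saff_field (a b k d e : K) :
  vf_act alpha (saff_field a b k (2 * d) (2 * e)) =
  c^-1 *: ham (quad b (- a) d (- e) (- k) f g).
Proof.
have alphaC x : alpha x%:MP = x%:MP.
  by rewrite -[x%:MP]mulr1 mul_mpolyC linearZ /= rmorph1.
rewrite /vf_act [jac alpha]fg -rmorphV ?unitfE //= !(rmorphB, rmorphD, rmorphM) /=.
rewrite !alphaC -/f -/g vecZ /quad /ham /dx /dy !mderivE.
by congr pair => /=; ring.
Qed.

Hypothesis charK : [pchar K] =i pred0.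

Lemma vf_image_saff2 D : vf_image alpha (@saff2 K) D <-> quad_fields f g D.
Proof.
have n2 : (2 : K) != 0 by rewrite ((pcharf0P K).1 charK).
split=> [[E /saff2P[a [b [k [d [e ->]]]]] <-]|[a [b [p [q [r ->]]]]]].
  rewrite -[d](divfK n2) -[e](divfK n2) ![_ / 2 * 2]mulrC vf_act_saff_field -hamZ.
  exists (c^-1 * b), (c^-1 * - a), (c^-1 * (d / 2)), (c^-1 * - (e / 2)), (c^-1 * - k).
  by congr ham; rewrite /quad; ring.
exists (saff_field (- (c * b)) (c * a) (- (c * r)) (2 * (c * p)) (2 * - (c * q))).
  by apply/saff2P; do 5!eexists.
rewrite vf_act_saff_field !opprK -hamZ -[quad a b p q r f g]mul1r.
rewrite -(mpolyC1 2) -(mulVf cn0).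
by congr ham; rewrite /quad; ring.
Qed.

End Image.

Lemma exists_endo f g :
  exists alpha : {lrmorphism Kxy K -> Kxy K}, alpha 'X_0 = f /\ alpha 'X_1 = g.
Proof. by exists (comp_mpoly [tuple f; g]); rewrite /= !comp_mpolyXU. Qed.

End Spans.

(** * Lie algebras of fields of constant divergence isomorphic to saff2 *)

Section Transport.
Variables (K : fieldType) (charK : [pchar K] =i pred0).
Variables (L : Vec K -> Prop) (L_sub : lie_subalgebra (@vf_lie K) L).
Hypothesis L_Vecc : forall D, L D -> in_Vecc D.
Variable phi : Vec K -> Vec K.
Hypothesis phi_lin :
  forall (a : K) u v, L u -> L v -> phi (a *: u + v) = a *: phi u + phi v.
Hypothesis phi_lie :
  forall u v, L u -> L v -> phi (vf_lie u v) = vf_lie (phi u) (phi v).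
Hypothesis phi_inj : forall u v, L u -> L v -> phi u = phi v -> u = v.
Hypothesis phi_im : forall w, saff2 w <-> exists2 u, L u & phi u = w.
Implicit Types (D E : Vec K) (u h : Kxy K).

Let n2 : (2 : K) != 0.
Proof. by rewrite ((pcharf0P K).1 charK). Qed.

Let L0 : L 0 := L_sub.1.1.

Let L_lin (k : K) D E : L D -> L E -> L (k *: D + E).
Proof. exact: L_sub.1.2. Qed.

Let LZ (k : K) D : L D -> L (k *: D).
Proof. by move=> LD; rewrite -[_ *: _]addr0; apply: L_lin. Qed.

Let L_lie D E : L D -> L E -> L (vf_lie D E).
Proof. exact: L_sub.2. Qed.

Let phi0 : phi 0 = 0.
Proof.
by apply: (addrI (phi 0)); rewrite addr0 -[X in X + _]scale1r -phi_lin // scale1r addr0.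
Qed.

Let phiZ (k : K) D : L D -> phi (k *: D) = k *: phi D.
Proof. by move=> LD; rewrite -[k *: D]addr0 phi_lin // phi0 addr0. Qed.

Let phi_saff_field D : L D -> exists a b c d e, phi D = saff_field a b c d e.
Proof. by move=> LD; apply/saff2P/phi_im; exists D. Qed.

Let preimage (a b c d e : K) : exists2 D, L D & phi D = saff_field a b c d e.
Proof. by apply/phi_im/saff2P; do 5!eexists. Qed.

Lemma vf_div_lie0 D E : L D -> L E -> vf_div (vf_lie D E) = 0.
Proof.
move=> /L_Vecc[c Dc] /L_Vecc[c' Ec]; rewrite vf_div_lie Dc Ec /vf_app /dx /dy.
by rewrite !mderivC !mulr0 !addr0 subrr.
Qed.

(** Perfectness of [saff2] is used in the explicit form
    m = [H, m'] + [c x d/dy, y d/dx], where H = x d/dx - y d/dy has nonzero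
    weights on every basis vector of [saff2] but itself. *)
Lemma L_div0 D : L D -> vf_div D = 0.
Proof.
move=> LD; have [a [b [c [d [e phiD]]]]] := phi_saff_field LD.
have [H LH phiH] := preimage 0 0 1 0 0.
have half (x : K) : exists y, x = 2 * y by exists (x / 2); rewrite mulrC divfK.
have [d' ed] := half d; have [e' ee] := half e; subst d e.
have [M LM phiM] := preimage (- a) b 0 d' (- e').
have [E LE phiE] := preimage 0 0 0 c 0.
have [F LF phiF] := preimage 0 0 0 0 1.
have -> : D = 1 *: vf_lie H M + vf_lie E F.
  have LHM : L (vf_lie H M) by apply: L_lie.
  have LEF : L (vf_lie E F) by apply: L_lie.
  apply: phi_inj; rewrite ?phi_lin ?phi_lie //; first exact: L_lin.
  rewrite phiD phiH phiM phiE phiF !vf_lie_saff_field saff_field_lin.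
  by congr saff_field; ring.
by rewrite vf_divD scale1r !vf_div_lie0 ?addr0.
Qed.

Lemma L_ham D : L D -> exists u, D = ham u.
Proof. by move=> /L_div0 /(div0_ham charK). Qed.

(** The translations d/dx and d/dy, seen in L, provide the coordinates f, g. *)
Section Frame.
Variables f g : Kxy K.
Hypotheses (Lf : L (ham f)) (phif : phi (ham f) = saff_field 1 0 0 0 0).
Hypotheses (Lg : L (ham g)) (phig : phi (ham g) = saff_field 0 1 0 0 0).

(** As [ham] is injective up to constants, a bracket that is known to
    correspond to a translation determines the Poisson bracket up to a
    constant. *)
Let poisson_translation u (k l : K) h :
  L (ham u) -> L (ham h) ->
  phi (vf_lie (ham u) (ham h)) = saff_field k l 0 0 0 ->
  exists m : K, poisson u h = m%:MP + k%:MP * f + l%:MP * g.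
Proof.
move=> Lu Lh phiuh.
have [|m eq_m] := @ham_inj _ charK (poisson u h) (k%:MP * f + l%:MP * g).
  rewrite -vf_lie_ham hamD !hamZ; apply: phi_inj.
  - exact: L_lie.
  - by apply: L_lin => //; apply: LZ.
  rewrite phiuh phi_lin ?phiZ ?phif ?phig //; last exact: LZ.
  rewrite -[l *: _]addr0 -saff_field0 !saff_field_lin.
  by congr saff_field; ring.
by exists m; rewrite eq_m; ring.
Qed.

(** [ham] forgets constants, which is why an unknown k appears in each bracket. *)
Lemma frame_brackets (a b c d e : K) u :
  L (ham u) -> phi (ham u) = saff_field a b c d e ->
  (exists k : K, poisson u f = k%:MP - c%:MP * f - d%:MP * g) /\
  (exists k : K, poisson u g = k%:MP - e%:MP * f + c%:MP * g).
Proof.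
move=> Lu phiu; split.
  have [|k ->] := @poisson_translation u (- c) (- d) f Lu Lf; last by exists k; ring.
  by rewrite phi_lie // phiu phif vf_lie_saff_field; congr saff_field; ring.
have [|k ->] := @poisson_translation u (- e) c g Lu Lg; last by exists k; ring.
by rewrite phi_lie // phiu phig vf_lie_saff_field; congr saff_field; ring.
Qed.

Lemma frame_nondegenerate : exists2 c : K, c != 0 & poisson f g = c%:MP.
Proof.
have [_ [c fg]] := frame_brackets Lf phif.
have {}fg : poisson f g = c%:MP by rewrite fg; ring.
exists c => //; apply/eqP => c0; rewrite c0 mpolyC0 in fg.
have [H LH phiH] := preimage 0 0 1 0 0.
have [E LE phiE] := preimage 0 0 0 1 0.
have [h eqH] := L_ham LH; have [e eqE] := L_ham LE; subst H E.
have [[k1 hf] [k2 hg]] := frame_brackets LH phiH.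
have [[k3 ef] [k4 eg]] := frame_brackets LE phiE.
have gg : ham g = 0.
  apply: (@poisson_nondegenerate _ charK f g h e k1 k2 k3 k4) => //.
  - by rewrite hf; ring.
  - by rewrite hg; ring.
  - by rewrite ef; ring.
  - by rewrite eg; ring.
have := phig; rewrite gg phi0 => /(congr1 snd) /= /esym.
rewrite rmorph1 !mpolyC0 !mul0r subr0 addr0 => /eqP.
by rewrite oner_eq0.
Qed.

Lemma L_quad D : L D <-> quad_fields f g D.
Proof.
have [c0 c0n0 fg] := frame_nondegenerate.
have c0ham a b c d e u : L (ham u) -> phi (ham u) = saff_field a b c (2 * d) (2 * e) ->
    exists k l : K, c0 *: ham u = ham (quad k l (- e) d c f g).
  move=> Lu phiu; have [[k uf] [l ug]] := frame_brackets Lu phiu.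
  exists l, (- k).
  rewrite (@ham_affine_brackets _ f g u c0 k (- c) (- d) l (- e)) ?opprK //.
    by rewrite uf; ring.
  by rewrite ug; ring.
split=> [LD|[a [b [p [q [r ->]]]]]].
  have [a [b [c [d [e phiD]]]]] := phi_saff_field LD; have [u eqD] := L_ham LD; subst D.
  have [|k [l c0u]] := @c0ham a b c (d / 2) (e / 2) u LD.
    by rewrite phiD ![2 * _]mulrC !divfK.
  exists (c0^-1 * k), (c0^-1 * l), (c0^-1 * - (e / 2)), (c0^-1 * (d / 2)), (c0^-1 * c).
  rewrite -[ham u](scalerK c0n0) c0u -hamZ.
  by congr ham; rewrite /quad; ring.
clear D.
(* A preimage with prescribed linear part realizes any quadratic part; the
   linear terms are then adjusted by multiples of ham f and ham g. *)
have [D LD phiD] := preimage 0 0 r (2 * q) (2 * - p).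
have [u eqD] := L_ham LD; subst D.
have [k [l]] := c0ham _ _ _ _ _ _ LD phiD; rewrite opprK => c0u.
suff -> : ham (quad a b p q r f g) =
    (a - k) *: ham f + ((b - l) *: ham g + c0 *: ham u).
  by apply: L_lin => //; apply: L_lin => //; apply: LZ.
by rewrite c0u -!hamZ -!hamD; congr ham; rewrite /quad; ring.
Qed.

(** The translations form an abelian ideal, and the radical contains every
    solvable ideal. *)
Lemma translations_in_radical R :
  is_solvable_radical (@vf_lie K) L R -> R (ham f) /\ R (ham g).
Proof.
case=> _ _ R_max.
pose I D := L D /\ exists a b, phi D = saff_field a b 0 0 0.
suff [I_ideal I_sol] : lie_ideal (@vf_lie K) L I /\ lie_solvable (@vf_lie K) I.
  by split; apply: (R_max I) => //; split=> //; do 2!eexists; eassumption.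
split; first split.
- split; first by split=> //; exists 0, 0; rewrite phi0 saff_field0.
  move=> k D E [LD [a [b phiD]]] [LE [a' [b' phiE]]]; split; first exact: L_lin.
  exists (k * a + a'), (k * b + b'); rewrite phi_lin // phiD phiE saff_field_lin.
  by congr saff_field; ring.
- by move=> D [].
- move=> D E LD [LE [a' [b' phiE]]]; split; first exact: L_lie.
  have [a [b [c [d [e phiD]]]]] := phi_saff_field LD.
  exists (- a' * c - b' * e), (- a' * d + b' * c).
  by rewrite phi_lie // phiD phiE vf_lie_saff_field; congr saff_field; ring.
exists 1%N => D [n [k [u [uI ->]]]]; rewrite big1 // => i _.
have [D1 [D2 [[L1 [a [b phi1]]] [L2 [a' [b' phi2]]] ->]]] := uI i.
rewrite (_ : vf_lie D1 D2 = 0) ?scaler0 //.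
apply: phi_inj => //; first exact: L_lie.
rewrite phi_lie // phi1 phi2 vf_lie_saff_field phi0 -saff_field0.
by congr saff_field; ring.
Qed.

End Frame.

Lemma saff_frame : exists f g (c : K),
  [/\ c != 0, poisson f g = c%:MP, forall D, L D <-> quad_fields f g D
    & forall R, is_solvable_radical (@vf_lie K) L R -> R (ham f) /\ R (ham g)].
Proof.
have [A LA phiA] := preimage 1 0 0 0 0; have [f eqA] := L_ham LA.
have [B LB phiB] := preimage 0 1 0 0 0; have [g eqB] := L_ham LB.
subst A B; have [c cn0 fg] := frame_nondegenerate LA phiA LB phiB.
exists f, g, c; split=> //; first exact: L_quad.
by move=> R; apply: translations_in_radical.
Qed.

End Transport.

Theorem proposition3p3 (K : closedFieldType) (charK : [pchar K] =i pred0)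
    (L : Vec K -> Prop)
    (L_sub : lie_subalgebra (@vf_lie K) L)
    (L_Vecc : forall D, L D -> in_Vecc D)
    (L_saff : lie_isomorphic (@vf_lie K) L (@saff2 K)) :
  (exists alpha : {lrmorphism Kxy K -> Kxy K},
      etale alpha /\ forall D, L D <-> vf_image alpha (@saff2 K) D) /\
  (forall R : Vec K -> Prop, is_solvable_radical (@vf_lie K) L R ->
   forall f g : Kxy K, basis_of_space [:: ham f; ham g] R ->
     (forall D, L D <->
        span_seq [:: ham f; ham g; ham (f ^+ 2); ham (g ^+ 2); ham (f * g)] D)
     /\
     exists alpha : {lrmorphism Kxy K -> Kxy K},
       [/\ alpha 'X_0 = f, alpha 'X_1 = g, etale alpha
         & forall D, L D <-> vf_image alpha (@saff2 K) D]).
Proof.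
have [phi [phi_lin phi_lie phi_inj phi_im]] := L_saff.
have [f0 [g0 [c0 [c0n0 f0g0 L_quad0 radL]]]] :=
  saff_frame charK L_sub L_Vecc phi_lin phi_lie phi_inj phi_im.
have image f g c : c != 0 -> poisson f g = c%:MP ->
    (forall D, L D <-> quad_fields f g D) ->
    exists alpha : {lrmorphism Kxy K -> Kxy K},
      [/\ alpha 'X_0 = f, alpha 'X_1 = g, etale alpha
        & forall D, L D <-> vf_image alpha (@saff2 K) D].
  move=> cn0 fg Lq; have [alpha [ax ay]] := exists_endo f g.
  rewrite -ax -ay in fg Lq; exists alpha; split=> //; first by exists c.
  by move=> D; rewrite Lq; apply: iff_sym; apply: vf_image_saff2 fg charK D.
split.
  have [alpha [_ _ alpha_et alphaL]] := image f0 g0 c0 c0n0 f0g0 L_quad0.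
  by exists alpha.
move=> R radR f g [_ R_span].
have [/R_span Rf0 /R_span Rg0] := radL R radR.
have [a [b [e ef]]] := span_ham2 charK Rf0.
have [a' [b' [e' eg]]] := span_ham2 charK Rg0.
have [[c cn0 fg] quadE] := frame_change ef eg f0g0 c0n0.
have L_quad_fg D : L D <-> quad_fields f g D by rewrite L_quad0 quadE.
split; last exact: image fg L_quad_fg.
by move=> D; rewrite L_quad_fg span_quad.
Qed.
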